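(* Every nonempty reduced two-coloured chain $(\Gamma,\lambda)$ is isomorphic, as a coloured chain, to the canonical value chain of an $N$-free ordered abelian group whose canonical factors are all isomorphic as groups to $\mathbb Z$. Consequently every nonempty chain occurs (up to order isomorphism) as $\mathcal V(G)$ for some $N$-free ordered abelian group $G$.
   Context: A two-coloured chain $(\Gamma,\lambda)$ is a totally ordered set $\Gamma$ with a map $\lambda:\Gamma\to\{\mathbf C,\mathbf A\}$; it is reduced if whenever $\gamma<\delta$ have the same colour there is $\eta$ of the opposite colour with $\gamma<\eta<\delta$. An isomorphism of coloured chains is a colour-preserving order isomorphism. An ordered group is a group $G$ (identity $e$) equipped with a partial order $\le$ such that $x\le y$ implies $axb\le ayb$ for all $a,b,x,y\in G$. It is $N$-free if it has no four distinct elements $a,b,c,d$ whose only strict comparabilities among themselves are $a<b$, $c<b$, $c<d$. A module of a poset $X$ is a subset $M$ such that for every $x\in X\setminus M$ and $m,m'\in M$: $x\le m\iff x\le m'$ and $m\le x\iff m'\le x$. A nonempty module $M$ is strong if every module is disjoint from $M$, contained in $M$, or contains $M$. $S(x,y)$ is the least strong module containing $x$ and $y$. The canonical (value) chain is $\mathcal V(G):=\{S(e,g):g\ne e\}$, ordered by inclusion, and for $H\in\mathcal V(G)$, $H^-:=\{e\}\cup\bigcup\{L\in\mathcal V(G):L\subsetneq H\}$. It is known that $\mathcal V(G)$ is a chain of convex subgroups and that $H^-$ is a proper convex normal subgroup of $H$. The canonical factors are the groups $H/H^-$ with the quotient order ($\alpha\le\beta$ iff $a\le b$ for some $a\in\alpha,b\in\beta$).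 For $N$-free $G$, each canonical factor is either totally ordered or equality-ordered (its order is equality), and $\mathcal V(G)$ is coloured by giving $H$ the colour $\mathbf C$ in the first case and $\mathbf A$ in the second. *)

(* Defs.v *)
From HB Require Import structures.
From mathcomp Require Import all_boot all_order all_algebra.
From mathcomp Require Import boolp classical_sets functions.

Set Implicit Arguments.
Unset Strict Implicit.
Unset Printing Implicit Defensive.

Import Order.TTheory.

Local Open Scope order_scope.
Local Open Scope group_scope.
Local Open Scope classical_set_scope.

Variant colour := colC | colA.

(* A chain is an [orderType]. *)
Definition reduced d (T : orderType d) (lambda : T -> colour) : Prop :=
  forall x y : T, x < y -> lambda x = lambda y ->
    exists2 z : T, x < z < y & lambda z <> lambda x.

HB.mixin Record Group_POrder_isOrderedGroup (d : Order.disp_t) G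
    of Group G & Order.POrder d G := {
  le_mulg : forall a b x y : G, x <= y -> a * x * b <= a * y * b
}.

#[short(type="orderedGroupType")]
HB.structure Definition OrderedGroup (d : Order.disp_t) :=
  {G of Group_POrder_isOrderedGroup d G & Group G & Order.POrder d G}.

Definition abelian_group (G : groupType) : Prop := forall x y : G, commute x y.

Section Posets.
Context {d : Order.disp_t} {X : porderType d}.
Implicit Types (M N : set X) (x y : X).

Definition module M : Prop :=
  forall x, ~ M x -> forall m m', M m -> M m' ->
    (x <= m) = (x <= m') /\ (m <= x) = (m' <= x).

Definition strong_module M : Prop :=
  [/\ M !=set0, module M &
      forall N, module N -> [\/ N `&` M = set0, N `<=` M | M `<=` N]].

Definition strong_span x y : set X := smallest strong_module [set x; y].

(* [smallest] is an intersection; this shows that the least strong module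
   containing [x] and [y] exists, so that [strong_span x y] is that module. *)
Lemma strong_span_strong x y : strong_module (strong_span x y).
Proof.
have subx M : strong_module M /\ [set x; y] `<=` M -> strong_span x y `<=` M.
  by move=> MP z Sz; apply: (Sz M).
have xS : strong_span x y x by move=> M [_ xyM]; apply: xyM; left.
split; first by exists x.
- move=> z /existsNP[M /not_implyP[[sM xyM] zM]] m m' mS m'S.
  have [_ mM _] := sM.
  by apply: (mM z zM); apply: (subx M (conj sM xyM)).
- move=> N mN.
  have [NS0|/set0P[z [Nz Sz]]] := eqVneq (N `&` strong_span x y) set0.
    by constructor 1.
  have [[M [[sM xyM] MN]]|noM] :=
    pselect (exists M, (strong_module M /\ [set x; y] `<=` M) /\ M `<=` N).
    by constructor 3; apply: subset_trans MN; apply: subx.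
  constructor 2 => n Nn M [sM xyM].
  have [_ _ /(_ N mN)[NM0|NM|MN]] := sM; last 2 first.
  - exact: NM.
  - by case: noM; exists M.
  have : (N `&` M) z by split => //; apply: Sz.
  by rewrite NM0.
Qed.

End Posets.

Definition N_free d (X : porderType d) : Prop :=
  ~ exists a b c e : X, uniq [:: a; b; c; e] /\
      [/\ a < b, c < b & c < e] /\ [/\ a >< c, a >< e & b >< e].

Section ValueChain.
Context {d : Order.disp_t} {G : orderedGroupType d}.
Implicit Types (H A B : set G).

Definition value_chain : set (set G) :=
  [set strong_span 1 g | g in [set g : G | g <> 1]].

Definition value_pred H : set G :=
  1 |` \bigcup_(L in [set L | value_chain L /\ L `<` H]) L.

(* The factor group H / H^- is encoded by its underlying set of cosets of H^-,
   viewed as subsets of G; its group law is the setwise product [set_mulg]. *)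
Definition canonical_factor H : set (set G) :=
  [set [set h * k | k in value_pred H] | h in H].

Definition set_mulg A B : set G := [set a * b | a in A & b in B].

Definition coset_le A B : Prop := exists a b, [/\ A a, B b & a <= b].

Definition totally_ordered_factor H : Prop :=
  forall A B, canonical_factor H A -> canonical_factor H B ->
    coset_le A B \/ coset_le B A.

Definition equality_ordered_factor H : Prop :=
  forall A B, canonical_factor H A -> canonical_factor H B ->
    (coset_le A B <-> A = B).

(* The factors being nontrivial, [H] has at most one colour, and exactly one
   when [G] is N-free. *)
Definition has_colour H (c : colour) : Prop :=
  match c with
  | colC => totally_ordered_factor H
  | colA => equality_ordered_factor H
  end.

Definition factor_isog_int H : Prop :=
  exists2 f : int -> set G, set_bij [set: int] (canonical_factor H) f &
    forall m n : int, f (m + n)%R = set_mulg (f m) (f n).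

End ValueChain.

Arguments value_chain {d} G.

Definition order_iso_value_chain d d' (T : orderType d)
    (G : orderedGroupType d') (phi : T -> set G) : Prop :=
  set_bij [set: T] (value_chain G) phi /\
  forall x y : T, x <= y <-> phi x `<=` phi y.

(* Main.v *)
(* The group consists of the finitely supported functions from Gamma to Z, with
   f < g when, at the largest place x where f and g differ, x has colour C and
   f x < g x; if x has colour A then f and g are incomparable. N-freeness is
   the ultrametric inequality for the largest place of difference. The least
   strong module containing 0 and g is the set of all f supported in the
   initial segment up to the largest place of the support of g: it is strong
   because the chain is reduced, and it is least because it is cut into two
   modules separating 0 from g by a threshold on the value at that place.

   For the second part, every chain has a reduced colouring. Consecutive
   elements get opposite colours, which is possible as the covering relation is
   a disjoint union of paths. The remaining points are coloured by opposing
   each point to its parent in the Cartesian tree of the chain with respect to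
   a well-order; this makes both colours dense wherever there are no jumps. *)

Require Import Defs.
From HB Require Import structures.
From mathcomp Require Import all_boot all_order all_algebra.
From mathcomp Require Import boolp classical_sets functions.
From mathcomp Require Import wochoice.
From Stdlib Require Import Relation_Operators.

Set Implicit Arguments.
Unset Strict Implicit.
Unset Printing Implicit Defensive.

Import Order.TTheory GRing.Theory Num.Theory.

Local Open Scope order_scope.
Local Open Scope group_scope.
Local Open Scope classical_set_scope.

(** * Alternating colourings of well-founded forests, and well-orders *)

(** With [Q p z] read as [p] being the parent of [z], well-founded recursion gives each point the
    opposite of its parent's value; roots get [False]. *)
Lemma alternating_predicate (T : Type) (Q : T -> T -> Prop) :
  well_founded Q -> (forall p q z, Q p z -> Q q z -> p = q) ->
  exists c : T -> Prop, forall p z, Q p z -> c z = ~ c p.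
Proof.
move=> Qwf Qfun.
pose F z (rec : forall p, Q p z -> Prop) := exists p (h : Q p z), ~ rec p h.
exists (Fix Qwf (fun=> Prop) F) => p z Qpz.
rewrite Fix_eq /F; last first.
  move=> x f g fg; suff -> : f = g by [].
  by apply: functional_extensionality_dep => u; apply: functional_extensionality_dep.
rewrite propeqE; split; first by move=> [q [/Qfun/(_ Qpz) ->]].
by move=> ?; exists p, Qpz.
Qed.

Lemma exists_well_order (T : Type) :
  exists R : T -> T -> Prop,
    [/\ forall x y, R x y -> R y x -> x = y,
        forall x y z, R x y -> R y z -> R x z &
        forall P : T -> Prop, (exists x, P x) ->
          exists2 x, P x & forall y, P y -> R x y].
Proof.
have [R Rwo] := well_ordering_principle {classic T}.
have Ranti (x y : T) : R x y -> R y x -> x = y.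
  move=> xy yx; have Rwo' := withinW (A := predT) Rwo.
  by apply: (wo_chain_antisymmetric Rwo' _ _ (introT andP (conj xy yx))).
have Rmin (P : T -> Prop) :
    (exists x, P x) -> exists2 x, P x & forall y, P y -> R x y.
  move=> [x Px].
  have [|z [[zP zmin] _]] := Rwo [pred y : {classic T} | `[< P y >]].
    by exists x; apply/asboolP.
  exists z; first exact/asboolP.
  by move=> y Py; apply: zmin; apply/asboolP.
exists R; split=> // x y z xy yz.
(* Transitivity comes from the least element of [x], [y], [z]: it is [x], or antisymmetry identifies
   two of the points. *)
have [|m mP min] := Rmin (fun w => [\/ w = x, w = y | w = z]).
  by exists x; constructor 1.
have mx : R m x by apply: min; constructor 1.
have my : R m y by apply: min; constructor 2.
have mz : R m z by apply: min; constructor 3.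
by case: mP => e; subst m => //; [rewrite (Ranti _ _ xy mx)|rewrite -(Ranti _ _ yz my)].
Qed.

(** * Existence of a reduced colouring on every chain *)

Section ReducedColouring.
Context {d : Order.disp_t} {T : orderType d}.
Implicit Types (x y z p q : T).

Definition covers x y : Prop := x < y /\ forall z, ~ x < z < y.

Definition component x : set T := [set y | clos_refl_sym_trans T covers x y].

Lemma covers_funl x y z : covers x z -> covers y z -> x = y.
Proof.
move=> [xz nx] [yz ny]; case: (ltgtP x y) => // h.
  by case: (nx y); rewrite h.
by case: (ny x); rewrite h.
Qed.

Lemma covers_funr x y z : covers x y -> covers x z -> y = z.
Proof.
move=> [xy ny] [xz nz]; case: (ltgtP y z) => // h.
  by case: (nz y); rewrite xy.
by case: (ny z); rewrite xz.
Qed.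

(* The components of the covering relation are paths; orienting each of them
   towards an arbitrary base point makes it well-founded. *)
Lemma colouring_alternating_on_covers :
  exists c : T -> Prop, forall x y, covers x y -> c x = ~ c y.
Proof.
have [[x0]|noT] := pselect (inhabited T); last first.
  by exists (fun=> True) => x; case: noT.
(* The choice depends only on the set [component x], so it is constant on each component. *)
pose base x := xget x0 (component x).
have component_base x : component x (base x).
  by apply: xgetPex; exists x; apply: rst_refl.
have base_component x y : component x y -> base x = base y.
  move=> xy; congr xget; apply/seteqP; split=> z; apply: rst_trans => //.
  exact: rst_sym.
have base_covers x y : covers x y -> base x = base y.
  by move=> xy; apply: base_component; apply: rst_step.
(* The parent of [z] is its neighbour one step nearer to the base point. *)
pose Q p z := covers p z /\ base z <= p \/ covers z p /\ p <= base z.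
have Qfun p q z : Q p z -> Q q z -> p = q.
  move=> [[pz bp]|[zp pb]] [[qz bq]|[zq qb]].
  - exact: covers_funl pz qz.
  - case: pz zq => [pz _] [zq _].
    by move: (lt_trans (le_lt_trans bp pz) (lt_le_trans zq qb)); rewrite ltxx.
  - case: zp qz => [zp _] [qz _].
    by move: (lt_trans (lt_le_trans zp pb) (le_lt_trans bq qz)); rewrite ltxx.
  - exact: covers_funr zp zq.
have Qcovers x y : covers x y -> Q x y \/ Q y x.
  move=> xy; have Bxy := base_covers _ _ xy; case: (xy) => [ltxy nxy].
  have [bx|xb] := leP (base x) x; first by left; left; rewrite -Bxy.
  right; right; split=> //; rewrite leNgt; apply/negP => bY.
  by apply: (nxy (base x)); rewrite xb bY.
have Qwf : well_founded Q.
  (* Parents being unique, accessibility passes along edges both ways, hence from the base point,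
     which has no parent, to its whole component. *)
  have acc_child x y : Q x y -> Acc Q x <-> Acc Q y.
    move=> Qxy; split=> [accx|accy]; last exact: Acc_inv accy _ Qxy.
    by constructor => z /Qfun /(_ Qxy) ->.
  have acc_component x y : component x y -> Acc Q x <-> Acc Q y.
    elim=> {x y} [x y xy|x|x y _|x y z _ + _]; [|tauto..].
    by case: (Qcovers x y xy) => /acc_child h; tauto.
  move=> z; rewrite (acc_component _ _ (component_base z)).
  constructor => p; rewrite /Q -(base_component _ _ (component_base z)).
  by move=> [[[+ _] +]|[[+ _] +]] => /lt_le_trans h /h; rewrite ltxx.
have [c cP] := alternating_predicate Qwf Qfun.
exists c => x y /Qcovers[/cP->|/cP //].
by rewrite notK.
Qed.

(** A point and its parent in the Cartesian tree get opposite values, so it is enough to find such a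
    pair inside any densely ordered interval. *)
Lemma colouring_alternating_in_gaps (R : T -> T -> Prop) :
  (forall x y, R x y -> R y x -> x = y) ->
  (forall x y z, R x y -> R y z -> R x z) ->
  (forall P : T -> Prop, (exists x, P x) -> exists2 x, P x & forall y, P y -> R x y) ->
  exists c : T -> Prop, forall x y, x < y ->
    (forall u v, x <= u -> u < v -> v <= y -> exists w, u < w < v) ->
    exists u v, [/\ x < u < y, x < v < y & c u = ~ c v].
Proof.
move=> Ranti Rtrans Rmin.
pose between x y w := x <= w <= y \/ y <= w <= x.
(* The ancestor and parent relations of the Cartesian tree of [T] with
   respect to the well-order [R]. *)
pose anc p z := forall w, between p z w -> R p w.
(* The parent is the [R]-greatest proper ancestor. *)
pose Q p z := [/\ p <> z, anc p z & forall w, anc w z -> w <> z -> R w p].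
have Qfun p q z : Q p z -> Q q z -> p = q.
  by move=> [pz ap mp] [qz aq mq]; apply: Ranti; [exact: mq|exact: mp].
have Rwf : well_founded (fun x y => R x y /\ x <> y).
  move=> x; apply: contrapT => nx.
  have [y ny ymin] := Rmin _ (ex_intro (fun x => ~ Acc _ x) x nx).
  apply: ny; constructor => z [Rzy zy]; apply: contrapT => /ymin Ryz.
  by apply: zy; apply: Ranti.
have Qwf : well_founded Q.
  move=> z; elim/(well_founded_ind Rwf): z => z IH; constructor => p [pz ap _].
  apply: IH; split=> //; apply: ap; case: (leP p z) => [pz'|/ltW zp].
    by left; rewrite pz' lexx.
  by right; rewrite zp lexx.
have [c cP] := alternating_predicate Qwf Qfun.
exists c => x y xy dense.
have [w0 xwy] := dense x y (lexx _) xy (lexx _).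
(* Three successive minima, with [z < q < p], make [p] the parent of [q]: an ancestor of [q] at or
   above [p] precedes [p], one at or below [z] precedes [z] and so [p], and one strictly between is
   [q] itself. *)
have [z /andP[xz zy] zmin] := Rmin (fun w => x < w < y) (ex_intro _ w0 xwy).
have [w1 zwy] := dense z y (ltW xz) zy (lexx _).
have [p /andP[zp py] pmin] := Rmin (fun w => z < w < y) (ex_intro _ w1 zwy).
have [w2 zwp] := dense z p (ltW xz) zp (ltW py).
have [q /andP[zq qp] qmin] := Rmin (fun w => z < w < p) (ex_intro _ w2 zwp).
have xp := lt_trans xz zp; have xq := lt_trans xz zq.
have qy := lt_trans qp py.
exists q, p; split; [by rewrite xq|by rewrite xp|apply: cP; split].
- by move=> pq; rewrite pq ltxx in qp.
- move=> w [/andP[pw wq]|/andP[qw wp]].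
    by move: (le_lt_trans (le_trans pw wq) qp); rewrite ltxx.
  by apply: pmin; rewrite (lt_le_trans zq qw) (le_lt_trans wp py).
- move=> w aw wq.
  have [pw|wp] := leP p w.
    by apply: aw; right; rewrite pw ltW.
  have [wz|zw] := leP w z.
    have Rwz : R w z by apply: aw; left; rewrite wz ltW.
    by apply: Rtrans Rwz _; apply: zmin; rewrite xp.
  exfalso; apply: wq; apply: Ranti; last by apply: qmin; rewrite zw.
  apply: aw; case: (leP w q) => [wq|/ltW qw]; first by left; rewrite wq lexx.
  by right; rewrite qw lexx.
Qed.

(** Points with a covering neighbour are coloured by [c], the others by [e]. If reducedness failed
    at [x < y], the colour would be constant on the closed interval; by [c] it would contain no
    jump, and then [e] would take both values inside it. *)
Lemma exists_reduced_colouring : exists lambda : T -> colour, reduced lambda.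
Proof.
have [c cP] := colouring_alternating_on_covers.
have [R [Ranti Rtrans Rmin]] := exists_well_order T.
have [e eP] := colouring_alternating_in_gaps Ranti Rtrans Rmin.
pose has_neighbour x := exists y, covers x y \/ covers y x.
pose chi x := (has_neighbour x /\ c x) \/ (~ has_neighbour x /\ e x).
pose lambda x := if `[< chi x >] then colC else colA.
have lambdaE x y : lambda x = lambda y -> chi x <-> chi y.
  by rewrite /lambda; case: asboolP; case: asboolP.
exists lambda => x y xy lxy; apply: contrapT => nz.
have mono z : x <= z <= y -> chi z <-> chi x.
  move=> /andP[xz zy]; apply: lambdaE.
  move: xz; rewrite le_eqVlt => /predU1P[->//|xz].
  move: zy; rewrite le_eqVlt => /predU1P[->//|zy].
  by apply: contrapT => ne; apply: nz; exists z; rewrite ?xz.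
have nocover u v : x <= u -> v <= y -> ~ covers u v.
  move=> xu vy uv; have [ltuv _] := uv.
  have := mono u; rewrite xu (le_trans (ltW ltuv) vy) => /(_ isT) chiu.
  have := mono v; rewrite vy (le_trans xu (ltW ltuv)) => /(_ isT) chiv.
  have nu : has_neighbour u by exists v; left.
  have nv : has_neighbour v by exists u; right.
  have := cP _ _ uv; move: chiu chiv; rewrite /chi => + + E; rewrite E; tauto.
have dense u v : x <= u -> u < v -> v <= y -> exists w, u < w < v.
  move=> xu uv vy; apply: contrapT => nw; apply: (nocover u v) => //.
  by split=> // z zP; apply: nw; exists z.
(* A neighbour of an interior point lies in the closed interval too, giving a jump there. *)
have lonely z : x < z < y -> ~ has_neighbour z.
  move=> /andP[xz zy] [w [zw|wz]].
    have wy : w <= y.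
      by rewrite leNgt; apply/negP => yw; apply: (zw.2 y); rewrite zy.
    exact: nocover (ltW xz) wy zw.
  have xw : x <= w.
    by rewrite leNgt; apply/negP => wx; apply: (wz.2 x); rewrite wx.
  exact: nocover xw (ltW zy) wz.
have [u [v [xuy xvy E]]] := eP x y xy dense.
have [nu nv] := (lonely _ xuy, lonely _ xvy).
have weak z : x < z < y -> x <= z <= y by move=> /andP[/ltW-> /ltW->].
by move: (mono u (weak _ xuy)) (mono v (weak _ xvy)); rewrite /chi E; tauto.
Qed.

End ReducedColouring.

(** * The ordered group of finitely supported functions *)

Lemma seq_greatest d (T : orderType d) (P : T -> Prop) (s : seq T) x :
  P x -> (forall y, P y -> y \in s) -> exists2 y, P y & forall z, P z -> z <= y.
Proof.
elim: s P x => [|a s IH] P x Px sP; first by move: (sP x Px).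
have [[y [Py ay]]|nP] := pselect (exists y, P y /\ a < y).
  have [||z [Pz az] zmax] := IH (fun z => P z /\ a < z) y.
  - by [].
  - move=> z [/sP]; rewrite in_cons => /predU1P[->|//].
    by rewrite ltxx.
  exists z => // w Pw; have [aw|wa] := ltP a w; first exact: zmax.
  exact: le_trans wa (ltW az).
have le_a z : P z -> z <= a.
  by move=> Pz; rewrite leNgt; apply/negP => az; apply: nP; exists z.
have [Pa|nPa] := pselect (P a); first by exists a.
apply: (IH P x Px) => y Py; move: (sP y Py); rewrite in_cons => /predU1P[ya|//].
by case: nPa; rewrite -ya.
Qed.

(* The colouring is a phantom parameter: it determines the order on the type. *)
Record lexsum d (T : orderType d) (lambda : T -> colour) := Lexsum {
  coef :> T -> int;
  coef_finite : exists s : seq T, forall x, coef x <> 0%R -> x \in s }.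

Section LexicographicSum.
Context {d : Order.disp_t} {T : orderType d} (lambda : T -> colour).
Local Notation G := (lexsum lambda).
Implicit Types (f g h k : G) (x y z : T).

Lemma lexsum_ext f g : (forall x, f x = g x) -> f = g.
Proof.
case: f g => [f Pf] [g Pg] /= /funext fg; subst g; congr (Lexsum lambda).
exact: Prop_irrelevance.
Qed.

Fact zero_finite : exists s : seq T, forall x, (0 : int)%R <> 0%R -> x \in s.
Proof. by exists [::]. Qed.

Fact opp_finite f : exists s : seq T, forall x, (- f x)%R <> 0%R -> x \in s.
Proof.
have [s sP] := coef_finite f; exists s => x fx; apply: sP => fx0.
by apply: fx; rewrite fx0 oppr0.
Qed.

Fact add_finite f g : exists s : seq T, forall x, (f x + g x)%R <> 0%R -> x \in s.
Proof.
have [[s sP] [t tP]] := (coef_finite f, coef_finite g).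
exists (s ++ t) => x fgx; rewrite mem_cat; apply/orP.
apply: contrapT => /not_orP[ns nt].
apply: fgx; have [fx0|/eqP/sP//] := eqVneq (f x) 0%R.
by have [gx0|/eqP/tP//] := eqVneq (g x) 0%R; rewrite fx0 gx0.
Qed.

Fact unit_finite x (n : int) :
  exists s : seq T, forall y, (if y == x then n else 0%R) <> 0%R -> y \in s.
Proof. by exists [:: x] => y; rewrite inE; case: eqP. Qed.

Definition lexsum0 : G := Lexsum lambda zero_finite.
Definition lexsum_opp f : G := Lexsum lambda (opp_finite f).
Definition lexsum_add f g : G := Lexsum lambda (add_finite f g).
Definition lexsum_unit x n : G := Lexsum lambda (unit_finite x n).

HB.instance Definition _ := gen_eqMixin G.
HB.instance Definition _ := gen_choiceMixin G.

Fact lexsum_addA : associative lexsum_add.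
Proof. by move=> f g h; apply: lexsum_ext => x /=; rewrite addrA. Qed.

Fact lexsum_addC : commutative lexsum_add.
Proof. by move=> f g; apply: lexsum_ext => x /=; rewrite addrC. Qed.

Fact lexsum_add0 : left_id lexsum0 lexsum_add.
Proof. by move=> f; apply: lexsum_ext => x /=; rewrite add0r. Qed.

Fact lexsum_addN : left_inverse lexsum0 lexsum_opp lexsum_add.
Proof. by move=> f; apply: lexsum_ext => x /=; rewrite addNr. Qed.

Fact lexsum_addr0 : right_id lexsum0 lexsum_add.
Proof. by move=> f; rewrite lexsum_addC lexsum_add0. Qed.

Fact lexsum_addrN : right_inverse lexsum0 lexsum_opp lexsum_add.
Proof. by move=> f; rewrite lexsum_addC lexsum_addN. Qed.

HB.instance Definition _ := isGroup.Build G
  lexsum_addA lexsum_add0 lexsum_addr0 lexsum_addN lexsum_addrN.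

(** An ultrametric distance with values in the chain: [x] is the distance of [f] and [g]. *)
Definition leading x f g : Prop := f x <> g x /\ forall y, x < y -> f y = g y.

Lemma leading_sym x f g : leading x f g -> leading x g f.
Proof. by move=> [fg eq]; split=> [/esym//|y /eq]. Qed.

Lemma leading_exists f g : f <> g -> exists x, leading x f g.
Proof.
move=> fg; have [x fgx] : exists x, f x <> g x.
  by apply: contrapT => /forallNP h; apply: fg; apply: lexsum_ext => x;
    apply: contrapT.
(* The group law is pointwise addition, so [f / g] is supported exactly where [f] and [g] differ. *)
have [s sP] := coef_finite (f / g).
have [|y fgy ymax] := @seq_greatest _ _ (fun x => f x <> g x) s x fgx.
  by move=> y fgy; apply: sP => /= /subr0_eq.
exists y; split=> // z yz; apply: contrapT => /ymax.
by rewrite leNgt yz.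
Qed.

Lemma leading_uniq x y f g : leading x f g -> leading y f g -> x = y.
Proof.
move=> [nx ex] [ny ey]; case: (ltgtP x y) => // h.
  by case: (ny (ex _ h)).
by case: (nx (ey _ h)).
Qed.

(** The isosceles form of the ultrametric inequality: the larger of two unequal distances is the
    third. *)
Lemma leading_transl x y f g h :
  x < y -> leading x f g -> leading y g h -> leading y f h.
Proof.
move=> xy [_ fg] [gh eq]; split=> [|z yz]; first by rewrite fg.
by rewrite fg ?eq // (lt_trans xy).
Qed.

Definition lexsum_lt_at x f g : Prop :=
  [/\ lambda x = colC, (f x < g x)%R & leading x f g].

Definition lexsum_lt f g : bool := `[< exists x, lexsum_lt_at x f g >].

Fact lexsum_lt_irr : irreflexive lexsum_lt.
Proof. by move=> f; apply/asboolP => -[x [_ _ []]]. Qed.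

Fact lexsum_lt_trans : transitive lexsum_lt.
Proof.
move=> g f h /asboolP[x [Cx fg xfg]] /asboolP[y [Cy gh ygh]]; apply/asboolP.
case: (ltgtP x y) => [xy|yx|exy].
- exists y; split=> //; first by rewrite xfg.2.
  exact: leading_transl xfg ygh.
- exists x; split=> //; first by rewrite -ygh.2.
  exact/leading_sym/(leading_transl yx)/leading_sym/xfg/leading_sym.
- subst y; have fh := lt_trans fg gh.
  exists x; split=> //; split=> [e|z xz]; first by rewrite e ltxx in fh.
  by rewrite xfg.2 ?ygh.2.
Qed.

HB.instance Definition _ :=
  Order.Lt_isPOrder.Build d G lexsum_lt_irr lexsum_lt_trans.

Lemma lexsum_ltE f g : (f < g) = `[< exists x, lexsum_lt_at x f g >].
Proof. by []. Qed.

Fact lexsum_le_mul f g h k : h <= k -> f * h * g <= f * k * g.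
Proof.
rewrite le_eqVlt => /predU1P[->//|]; rewrite lexsum_ltE => /asboolP[x [Cx hk [ne eq]]].
apply/ltW; rewrite lexsum_ltE; apply/asboolP; exists x; split=> //=.
  by rewrite ltrD2r ltrD2l.
by split=> [/addIr/addrI//|y /eq /= ->].
Qed.

HB.instance Definition _ :=
  Group_POrder_isOrderedGroup.Build d G lexsum_le_mul.

Lemma lexsum_abelian : abelian_group G.
Proof. by move=> f g; apply: lexsum_addC. Qed.

Lemma leading_compare x f g :
  leading x f g -> f >=< g <-> lambda x = colC.
Proof.
move=> xfg; split=> [|Cx]; last first.
  case: (ltgtP (f x) (g x)) => [fg|gf|/xfg.1//].
    by apply: lt_comparable; apply/asboolP; exists x.
  rewrite comparable_sym; apply: lt_comparable; apply/asboolP; exists x.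
  by split=> //; apply: leading_sym.
have nfg : f <> g by move=> e; case: xfg => h _; apply: h; rewrite e.
rewrite /Order.comparable !le_eqVlt => /orP[]/predU1P[]; try by move=> /esym.
- by [].
- by move=> /asboolP[y [Cy _ /(leading_uniq xfg) ->]].
- by move=> /asboolP[y [Cy _ /leading_sym/(leading_uniq xfg) ->]].
Qed.

Lemma leading_lt x f g :
  leading x f g -> (f < g) = `[< lambda x = colC /\ (f x < g x)%R >].
Proof.
move=> xfg; apply/asbool_equiv_eq; split=> [[y [Cy fg yfg]]|[Cx fg]].
  by rewrite (leading_uniq xfg yfg).
by exists x.
Qed.

(** The three comparable pairs have distances of colour C. Were two consecutive distances unequal,
    the larger would make an incomparable pair comparable; so all equal [x]. Then [f] and [h] must
    agree at [x], so [f] and [k] differ there and are comparable. *)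
Lemma lexsum_N_free : N_free G.
Proof.
move=> [f [g [h [k [fghk [[fg hg hk] [fh fk gk]]]]]]].
move: fg hg hk => /asboolP[x [Cx fg xfg]] /asboolP[y [Cy hg yhg]].
move=> /asboolP[z [Cz hk zhk]].
have exy : x = y.
  apply: contrapT => /eqP; rewrite neq_lt => /orP[lxy|lyx]; move/negP: fh; apply.
    apply/(leading_compare (x := y)) => //.
    exact: leading_transl lxy xfg (leading_sym yhg).
  apply/(leading_compare (x := x)) => //.
  exact/leading_sym/(leading_transl lyx yhg)/leading_sym.
have eyz : y = z.
  apply: contrapT => /eqP; rewrite neq_lt => /orP[lyz|lzy]; move/negP: gk; apply.
    apply/(leading_compare (x := z)) => //.
    exact: leading_transl lyz (leading_sym yhg) zhk.
  apply/(leading_compare (x := y)) => //.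
  exact/leading_sym/(leading_transl lzy (leading_sym zhk)).
subst y z; have fhx : f x = h x.
  apply: contrapT => ne; move/negP: fh; apply.
  apply/(leading_compare (x := x)) => //; split=> // w xw.
  by rewrite xfg.2 ?yhg.2.
move/negP: fk; apply; apply/(leading_compare (x := x)) => //; split=> [e|w xw].
  by move: hk; rewrite -e fhx ltxx.
by rewrite xfg.2 // -yhg.2 // zhk.2.
Qed.

(** * Modules and strong modules of the group *)

(** A point outside a module is comparable with all of it or with none of it. *)
Lemma module_leading (M : set G) x y f g h :
  module M -> ~ M f -> M g -> M h -> leading x f g -> leading y f h ->
  lambda x = lambda y.
Proof.
move=> mM nMf Mg Mh /leading_compare xfg /leading_compare yfh.
have [e1 e2] := mM f nMf g h Mg Mh.
have : lambda x = colC <-> lambda y = colC.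
  by rewrite -xfg -yfh /Order.comparable e1 e2.
by case: (lambda x) (lambda y) => [] [] // [] => [/(_ erefl)|_ /(_ erefl)].
Qed.

(** The relation of [f] to [g] is read off their distance and the sign of the difference there, by
    [leading_lt]. *)
Lemma module_of_leading (M : set G) :
  (forall f, ~ M f -> exists x, forall g, M g -> leading x f g /\
     forall h, M h -> (f x < g x)%R = (f x < h x)%R) -> module M.
Proof.
move=> hM f nMf g h Mg Mh; have [x xP] := hM f nMf.
have [[xfg e] [xfh _]] := (xP g Mg, xP h Mh).
have [fg fh] : f <> g /\ f <> h by split=> E; apply: nMf; rewrite E.
have gf k : leading x f k -> (k x < f x)%R = ~~ (f x < k x)%R.
  by move=> [/eqP/negPf nfk _]; case: ltgtP nfk.
rewrite !le_eqVlt; split; congr (_ || _).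
- by move/eqP/negPf: fg => ->; move/eqP/negPf: fh => ->.
- by rewrite !(leading_lt xfg, leading_lt xfh) (e h Mh).
- by rewrite ![_ == f]eq_sym; move/eqP/negPf: fg => ->; move/eqP/negPf: fh => ->.
- rewrite (leading_lt (leading_sym xfg)) (leading_lt (leading_sym xfh)).
  by rewrite (gf g) // (gf h) // (e h Mh).
Qed.

Definition initial x : set G := [set f | forall y, x < y -> f y = 0%R].

Definition initial_strict x : set G := [set f | forall y, x <= y -> f y = 0%R].

(** The two values of [b] give complementary halves of [initial x], above and below the threshold
    [t]. *)
Definition cut x (t : int) (b : bool) : set G :=
  [set f | initial x f /\ (t <= f x)%R = b].

Lemma notin_initial x f : ~ initial x f ->
  exists y, x < y /\ forall g, initial x g -> leading y f g.
Proof.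
move=> nf; have : f <> 1 by move=> e; apply: nf; rewrite e.
move=> /leading_exists[y yf1].
have xy : x < y.
  by rewrite ltNge; apply/negP => yx; apply: nf => z xz; apply: yf1.2;
    apply: le_lt_trans xz.
exists y; split=> // g ig; split=> [|z yz].
  by rewrite (ig y xy); apply: yf1.1.
by rewrite (ig z (lt_trans xy yz)) yf1.2.
Qed.

(** A point of the other half differs from the whole cut at [x], always in the direction given by
    [b]; a point outside [initial x] differs from it at a place where the cut vanishes. *)
Lemma module_cut x t b : module (cut x t b).
Proof.
apply: module_of_leading => f ncf.
have [If|/notin_initial[y [xy yP]]] := pselect (initial x f).
  have ftb : (t <= f x)%R = ~~ b.
    by apply/eqP/negPn/negP => ne; apply: ncf; split=> //; case: (_ <= _)%R b ne => [] [].
  have fg g : cut x t b g -> (f x < g x)%R = b.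
    move=> [_]; case: b ftb {ncf} => /= [/negbT|] ft gt; rewrite -?ltNge in ft.
      exact: lt_le_trans ft gt.
    move: gt => /negbT; rewrite -ltNge => gt.
    by apply/negbTE; rewrite -leNgt ltW // (lt_le_trans gt ft).
  exists x => g cg; split; last by move=> h ch; rewrite !fg.
  split; last by move=> y xy; rewrite If ?cg.1.
  by move=> e; case: cg => _; rewrite -e ftb; case: b {ncf ftb fg}.
exists y => g [Ig _]; split; first exact: yP.
by move=> h [Ih _]; rewrite Ig ?Ih.
Qed.

Lemma module_initial x : module (initial x).
Proof.
apply: module_of_leading => f /notin_initial[y [xy yP]]; exists y => g Ig.
by split; [exact: yP|move=> h Ih; rewrite Ig ?Ih].
Qed.

(** If a module [N] contains [g] inside and [h] outside [initial x] but misses [f] inside, then the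
    distances [z] from [f] to [g] and [y] from [f] to [h] have one colour, and reducedness gives [w]
    of the other colour between them. *)
Lemma strong_initial x : reduced lambda -> strong_module (initial x).
Proof.
move=> lred; split; first by exists 1.
  exact: module_initial.
move=> N mN; have [NI0|/set0P[g [Ng Ig]]] := eqVneq (N `&` initial x) set0.
  by constructor 1.
have [NI|/existsNP[h /not_implyP[Nh /notin_initial[y [xy yP]]]]] :=
  pselect (N `<=` initial x); first by constructor 2.
constructor 3 => f If; apply: contrapT => nNf.
have /leading_exists[z zfg] : f <> g by move=> e; apply: nNf; rewrite e.
have zx : z <= x.
  by rewrite leNgt; apply/negP => xz; apply: zfg.1; rewrite If ?Ig.
have yfh : leading y f h by apply: leading_sym; apply: yP.
have lzy := module_leading mN nNf Ng Nh zfg yfh.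
have [w /andP[zw wy] lw] := lred z y (le_lt_trans zx xy) lzy.
(* Changing [f] at [w] puts [k] at distance [w] from [f] and [g], and [y] from [h]. If [k] is in
   [N], [f] sees [N] at [z] and [w]; if not, [k] sees it at [w] and [y]. Both contradict the colour
   of [w]. *)
pose k : G := f * lexsum_unit w 1%R.
have kE u : k u = (f u + if u == w then 1 else 0)%R by [].
have wkf : leading w k f.
  split=> [|u wu]; rewrite kE.
    by rewrite eqxx => /eqP; rewrite -subr_eq0 addrAC subrr add0r.
  by rewrite gt_eqF // addr0.
have [Nk|nNk] := pselect (N k).
  exact/lw/esym/(module_leading mN nNf Ng Nk zfg)/leading_sym.
apply: lw; rewrite lzy; apply: (module_leading mN nNk Ng Nh).
  exact/leading_sym/(leading_transl zw (leading_sym zfg))/leading_sym.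
exact: leading_transl wy wkf yfh.
Qed.

Lemma strong_span_initial x g :
  reduced lambda -> leading x g 1 -> strong_span 1 g = initial x.
Proof.
move=> lred xg1; apply/seteqP; split=> [f|f If M [[_ mM sM] M1g]].
  apply; split; first exact: strong_initial.
  by move=> _ [->|->] // y xy; apply: xg1.2.
have [M1 Mg] : M 1 /\ M g by split; apply: M1g; [left|right].
have Ig : initial x g by move=> y; apply: xg1.2.
(* The larger of [0] and [g x] is a threshold separating them. *)
have [t tP] : exists t : int, (t <= 0)%R <> (t <= g x)%R.
  have gx0 : g x != 0%R by apply/eqP; apply: xg1.1.
  case: (ltgtP (g x) 0%R) gx0 => // [g0|g0] _.
    by exists 0%R; rewrite lexx leNgt g0.
  by exists (g x); rewrite lexx leNgt g0.
have splits b : exists u v, [/\ M u, M v, cut x t b u & ~ cut x t b v].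
  have I1 : initial x 1 by [].
  have [e|ne] := eqVneq (t <= 0)%R b.
    by exists 1, g; split=> // -[_]; rewrite -e => /esym.
  exists g, 1; split=> //; last by move=> -[_ e]; rewrite e eqxx in ne.
  by split=> //; case: (t <= 0)%R (t <= g x)%R b tP ne => [] [] [].
(* The half containing [f] meets [M] without containing it, so, [M] being strong, lies in [M]. *)
have [u [v [Mu Mv cu ncv]]] := splits (t <= f x)%R.
have [e|cM|] := sM _ (@module_cut x t (t <= f x)%R).
- suff : set0 u by []. by rewrite -e.
- exact: cM.
- by move=> /(_ _ Mv).
Qed.

Lemma leading_unit x n : n != 0%R -> leading x (lexsum_unit x n) 1.
Proof. by move=> /eqP n0; split=> [|y xy] /=; rewrite ?eqxx // gt_eqF. Qed.

Lemma initial_unit x n : initial x (lexsum_unit x n).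
Proof. by move=> y xy /=; rewrite gt_eqF. Qed.

Lemma initial_le x y : initial x `<=` initial y <-> x <= y.
Proof.
split=> [xy|xy f If z yz]; last by apply: If; apply: le_lt_trans yz.
rewrite leNgt; apply/negP => yx.
by have := xy _ (@initial_unit x 1%R) x yx; rewrite /= eqxx.
Qed.

Lemma initial_mul x f g : initial x f -> initial x g -> initial x (f * g).
Proof. by move=> If Ig y xy; rewrite /= If ?Ig. Qed.

Lemma initial_inv x f : initial x f -> initial x f^-1.
Proof. by move=> If y xy; rewrite /= If. Qed.

Lemma initial_lt x y : initial x `<` initial y <-> x < y.
Proof.
rewrite /proper initial_le; split=> [[xy nyx]|xy].
  by rewrite ltNge; apply/negP => /initial_le.
by split; [exact: ltW|rewrite initial_le leNgt xy].
Qed.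

Lemma initial_inj : injective initial.
Proof.
by move=> x y xy; apply/eqP; rewrite eq_le; apply/andP; split;
  apply/initial_le; rewrite xy.
Qed.

Lemma initial_strictE x f : initial_strict x f <-> initial x f /\ f x = 0%R.
Proof.
split=> [If|[If fx] y]; first by split=> [y xy|]; apply: If => //; apply: ltW.
by rewrite le_eqVlt => /predU1P[<-//|/If].
Qed.

Lemma initial_div x f g : initial x f -> initial x g -> f x = g x ->
  initial_strict x (f^-1 * g).
Proof.
move=> If Ig fg; apply/initial_strictE; split; last by rewrite /= fg addNr.
by apply: initial_mul => //; apply: initial_inv.
Qed.

Lemma leading_initial x f g : initial x f -> initial x g -> f x <> g x ->
  leading x f g.
Proof. by move=> If Ig fg; split=> // y xy; rewrite If ?Ig. Qed.

(** * The value chain, its colours and its factors *)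

Section Reduced.
Hypothesis lred : reduced lambda.

Lemma value_chain_lexsum (H : set G) : value_chain G H <-> exists x, H = initial x.
Proof.
split=> [[g /leading_exists[x xg] <-]|[x ->]].
  by exists x; apply: strong_span_initial.
exists (lexsum_unit x 1%R); last by apply: strong_span_initial => //; apply: leading_unit.
by move=> e; have [] := @leading_unit x 1%R isT; rewrite e.
Qed.

(** A nontrivial element vanishing from [x] on has its leading place [y] below [x], so it lies in
    [initial y]. *)
Lemma value_pred_lexsum x : value_pred (initial x) = initial_strict x.
Proof.
apply/seteqP; split.
  move=> f [->//|[L [/value_chain_lexsum[y ->] /initial_lt yx] If]] z xz.
  by apply: If; apply: lt_le_trans xz.
move=> f If.
have [->|/leading_exists[y yf1]] := pselect (f = 1); first by left.
have yx : y < x by rewrite ltNge; apply/negP => xy; apply: yf1.1; apply: If.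
right; exists (initial y); last by move=> z; apply: yf1.2.
by split; [apply/value_chain_lexsum; exists y|apply/initial_lt].
Qed.

(** The cosets of [initial_strict x] in [initial x]; as a function of [n], the isomorphism from the
    integers to the factor. *)
Definition slice x (n : int) : set G := [set f | initial x f /\ f x = n].

Lemma slice_unit x n : slice x n (lexsum_unit x n).
Proof. by split; [exact: initial_unit|rewrite /= eqxx]. Qed.

Lemma canonical_factor_lexsum x (A : set G) :
  canonical_factor (initial x) A <-> exists n, A = slice x n.
Proof.
have coset f : initial x f ->
    [set f * k | k in value_pred (initial x)] = slice x (f x).
  move=> If; rewrite value_pred_lexsum; apply/seteqP.
  split=> [_ [k /initial_strictE[Ik kx] <-]|g [Ig gx]].
    by split; [exact: initial_mul|rewrite /= kx addr0].
  by exists (f^-1 * g); [exact: initial_div|rewrite mulgA mulgV mul1g].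
split=> [[f If <-]|[n ->]]; first by exists (f x); apply: coset.
by exists (lexsum_unit x n); [|rewrite coset /= ?eqxx //]; apply: initial_unit.
Qed.

(** Elements of distinct slices are at distance [x], so the colour of [x] alone decides whether they
    are comparable. *)
Lemma has_colour_lexsum x : has_colour (initial x) (lambda x).
Proof.
case lx: (lambda x) => A B /canonical_factor_lexsum[m ->] /canonical_factor_lexsum[n ->].
  have [mx nx] := (slice_unit x m, slice_unit x n).
  have [mn|mn] := eqVneq m n.
    by left; exists (lexsum_unit x m), (lexsum_unit x m); split=> //; rewrite mn.
  have /leading_compare/proj2/(_ lx)/orP[le|le] :
      leading x (lexsum_unit x m) (lexsum_unit x n).
    by apply: leading_initial; [exact: initial_unit..|rewrite /= eqxx; apply/eqP].
  - by left; exists (lexsum_unit x m), (lexsum_unit x n).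
  - by right; exists (lexsum_unit x n), (lexsum_unit x m).
split=> [[f [g [[If fx] [Ig gx] fg]]]|<-]; last first.
  by exists (lexsum_unit x m), (lexsum_unit x m); split=> //; apply: slice_unit.
have [->//|/eqP mn] := eqVneq m n.
have /leading_compare/proj1 : leading x f g.
  by apply: leading_initial => //; rewrite fx gx.
by rewrite lx /Order.comparable fg => /(_ isT).
Qed.

Lemma factor_lexsum x : factor_isog_int (initial x).
Proof.
exists (slice x) => [|m n].
  split=> [n _|m n _ _ mn|A /canonical_factor_lexsum[n ->]].
  - by apply/canonical_factor_lexsum; exists n.
  - by have := slice_unit x m; rewrite mn => -[_]; rewrite /= eqxx.
  - by exists n.
apply/seteqP; split=> [f [If fx]|_ [f [If fx] [g [Ig gx] <-]]]; last first.
  by split; [exact: initial_mul|rewrite /= fx gx].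
exists (lexsum_unit x m); first exact: slice_unit.
exists ((lexsum_unit x m)^-1 * f); last by rewrite mulgA mulgV mul1g.
split; first by apply: initial_mul => //; apply: initial_inv; apply: initial_unit.
by rewrite /= eqxx fx addKr.
Qed.

Lemma initial_value_chain_iso : order_iso_value_chain initial.
Proof.
split; last by move=> x y; rewrite initial_le.
split=> [x _|x y _ _ /initial_inj//|H /value_chain_lexsum[x ->]].
  by apply/value_chain_lexsum; exists x.
by exists x.
Qed.

End Reduced.
End LexicographicSum.

Theorem theorem9p2 :
  (forall (d : Order.disp_t) (Gamma : orderType d) (lambda : Gamma -> colour),
     inhabited Gamma -> reduced lambda ->
     exists (d' : Order.disp_t) (G : orderedGroupType d'),
       [/\ N_free G,
           abelian_group G,
           (exists phi : Gamma -> set G,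
              order_iso_value_chain phi /\
              forall x : Gamma, has_colour (phi x) (lambda x)) &
           forall H : set G, value_chain G H -> factor_isog_int H]) /\
  (forall (d : Order.disp_t) (Gamma : orderType d),
     inhabited Gamma ->
     exists (d' : Order.disp_t) (G : orderedGroupType d'),
       [/\ N_free G,
           abelian_group G &
           exists phi : Gamma -> set G, order_iso_value_chain phi]).
Proof.
split=> [d Gamma lambda _ lred|d Gamma _].
  exists d, (lexsum lambda : orderedGroupType d); split.
  - exact: lexsum_N_free.
  - exact: lexsum_abelian.
  - exists (@initial _ _ lambda); split; first exact: initial_value_chain_iso.
    exact: has_colour_lexsum.
  - by move=> H /(value_chain_lexsum lred)[x ->]; apply: factor_lexsum.
have [lambda lred] := @exists_reduced_colouring _ Gamma.
exists d, (lexsum lambda : orderedGroupType d); split.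
- exact: lexsum_N_free.
- exact: lexsum_abelian.
- by exists (@initial _ _ lambda); apply: initial_value_chain_iso.
Qed.
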